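(* Let $k\ge 2$ be an integer, $n=3k-1$, and let $x_0,x_1,\dots,x_{n-1}$ be the eigenvalues of the adjacency matrix of the Andrásfai graph $\mathrm{And}(k)$, indexed by $x_l=\sum_{j=0}^{k-1}\omega^{(3j+1)l}$ with $\omega=e^{2\pi i/n}$. Then $x_k=x_{2k-1}$, and this is the smallest eigenvalue of the adjacency matrix, i.e. $x_k\le x_l$ for all $0\le l\le n-1$.
   Context: For an integer $k\ge 1$ put $n=3k-1$. The Andrásfai graph $\mathrm{And}(k)$ is the Cayley graph $\mathrm{Cay}(\mathbb{Z}_n,S)$ of the additive group $\mathbb{Z}_n=\{0,1,\dots,n-1\}$ with connection set $S=\{x\in\mathbb{Z}_n : x\equiv 1 \bmod 3\}=\{1,4,7,\dots,3k-2\}$, where the congruence mod $3$ is for the representatives $0,1,\dots,n-1$. That is, the vertices are the elements of $\mathbb{Z}_n$, and $u,v$ are adjacent iff $v-u\in S$ (the set $S$ satisfies $S=-S$ and $0\notin S$). The adjacency matrix is circulant, and its eigenvalues, listed with multiplicity, are the real numbers $x_l=\sum_{j=0}^{k-1}\omega^{(3j+1)l}$, $0\le l\le n-1$, where $\omega=e^{2\pi i/n}$; they are not necessarily listed in decreasing order. *)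

(* Defs.v *)
From mathcomp Require Import all_boot all_order all_algebra.
From mathcomp Require Import reals sequences exp trigo.
From mathcomp Require Export complex.

Set Implicit Arguments.
Unset Strict Implicit.
Unset Printing Implicit Defensive.

Import Order.TTheory GRing.Theory Num.Theory.
Local Open Scope ring_scope.
Local Open Scope complex_scope.

Definition cayley (G : finZmodType) (S : {set G}) : rel G :=
  fun u v => v - u \in S.

Definition adjacency_mx (C : nzRingType) (n : nat) (e : rel 'I_n) : 'M[C]_n :=
  \matrix_(u, v) (e u v)%:R.

Definition andrasfai_order (k : nat) : nat := (3 * k - 1)%N.

(* 'Z_n has carrier {0, ..., n-1} for n >= 2, i.e. for k >= 1; the residue
   modulo 3 is that of the canonical representative. *)
Definition andrasfai_set (k : nat) : {set 'Z_(andrasfai_order k)} :=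
  [set x : 'Z_(andrasfai_order k) | (x %% 3 == 1)%N].

Definition andrasfai (k : nat) : rel 'Z_(andrasfai_order k) :=
  cayley (andrasfai_set k).

Section Eigenvalues.
Variable R : realType.

Definition cexp (z : R[i]) : R[i] :=
  let: a +i* b := z in (expR a)%:C * (cos b +i* sin b).

Definition omega (n : nat) : R[i] := cexp (0 +i* (2 * pi / n%:R)).

Definition andrasfai_eig (k l : nat) : R[i] :=
  \sum_(0 <= j < k) omega (andrasfai_order k) ^+ ((3 * j + 1) * l).

Definition andrasfai_mx (k : nat) := adjacency_mx R[i] (@andrasfai k).

End Eigenvalues.

(* Main.v *)
Require Import Defs.
From mathcomp Require Import all_boot all_order all_algebra.
From mathcomp Require Import reals.
From mathcomp Require Import exp trigo ring lra zify.
Set Implicit Arguments.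
Unset Strict Implicit.
Unset Printing Implicit Defensive.

Import Order.TTheory GRing.Theory Num.Theory.
Local Open Scope ring_scope.

(** Write n = 3k - 1 and w = exp (2 i pi / n).  A Cayley graph of Z_n has a
    circulant adjacency matrix, which the Fourier (Vandermonde) matrix
    (w ^ (u l))_{u, l} diagonalises: each column is an eigenvector, with the
    character sum over the connection set as eigenvalue, and the matrix is
    invertible because w is a primitive n-th root of unity.  This gives the
    characteristic polynomial (char_poly_cayley_Zp), hence all eigenvalues.

    For the ordering, put z = w ^ l with 0 < l < n.  The eigenvalue x_l is a
    geometric sum of ratio z ^ 3, so (z ^ 3 - 1) x_l = z ^ (3k + 1) - z, and
    z ^ (3k + 1) = z ^ 2 because 3k + 1 = n + 2.  Cancelling z - 1 leaves
    (z ^ 2 + z + 1) x_l = z, and dividing by z,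
      x_l = 1 / (1 + 2 cos (2 pi l / n))             (andrasfai_eigE).
    The denominator takes the same value at l and n - l, which gives
    x_k = x_(2k-1) and reduces everything to l <= n / 2, where the cosine
    decreases with l.  Since cos (2 pi / 3) = - 1 / 2, the denominator is
    positive for l < n / 3 and negative for l > n / 3.  So the smallest x_l
    comes from the negative denominator closest to 0, the one at the least
    l above n / 3 = k - 1 / 3, which is l = k. *)

(** * Spectrum of a circulant graph *)

Section Circulant.
Variable F : fieldType.

(** With X the indeterminate, P also intertwines X - A and X - D over the
    polynomials, where det P is still nonzero and can be cancelled. *)
Lemma char_poly_intertwine n (P A D : 'M[F]_n) :
  \det P != 0 -> A *m P = P *m D -> char_poly A = char_poly D.
Proof.
move=> nzP AP; have nzPp : \det (map_mx polyC P) != 0.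
  by rewrite det_map_mx polyC_eq0.
apply: (mulfI nzPp); rewrite [LHS]mulrC -!det_mulmx; congr (\det _).
rewrite /char_poly_mx mulmxBl mulmxBr -!map_mxM AP; congr (_ - _).
by rewrite mul_scalar_mx mul_mx_scalar.
Qed.

(** The l-th column of the Vandermonde matrix is the character u |-> w ^ (u l);
    translating the summation variable by u shows that it is an eigenvector. *)
Lemma char_poly_cayley_Zp n (S : {set 'Z_n}) (w : F) :
  (1 < n)%N -> n.-primitive_root w ->
  char_poly (adjacency_mx F (cayley S)) =
    \prod_(0 <= l < n) ('X - (\sum_(s in S) w ^+ (s * l))%:P).
Proof.
case: n S => [|[|m]] // S _ prim_w; set n := m.+2 in S prim_w *.
pose V := Vandermonde n (\row_(j < n) w ^+ j).
pose D := diag_mx (\row_(j < n) \sum_(s in S) w ^+ (s * j)).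
have detV : \det V != 0.
  rewrite det_Vandermonde; apply/prodf_neq0 => i _; apply/prodf_neq0 => j ltij.
  rewrite !mxE subr_eq0 (eq_prim_root_expr prim_w) !modn_small //.
  by rewrite neq_ltn ltij orbT.
have AV : adjacency_mx F (cayley S) *m V = V *m D.
  apply/matrixP => u l; rewrite mul_mx_diag !mxE mulr_sumr.
  (* Substitute v = u + s for the neighbour v of u, so that s ranges over S. *)
  rewrite (reindex_inj (addrI u)) /= [RHS]big_mkcond /=.
  apply: eq_bigr => s _; rewrite !mxE /cayley addrAC subrr add0r.
  case: (s \in S); rewrite ?mul0r // mul1r -!exprM -exprD.
  (* The sum u + s is reduced modulo n; this is harmless in an exponent of w. *)
  apply/eqP; rewrite (eq_prim_root_expr prim_w) /=.
  by rewrite -modnMmr modn_mod modnMmr [(s * l)%N]mulnC -mulnDr.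
rewrite (char_poly_intertwine detV AV) char_poly_trig.
  by rewrite [RHS]big_mkord; apply: eq_bigr => i _; rewrite !mxE eqxx.
exact: diag_mx_is_trig.
Qed.
End Circulant.

(** Enumerates the connection set of the graph; the range stops at 3k - 2,
    which is itself congruent to 1 modulo 3. *)
Lemma sum_congr1_mod3 (V : nmodType) (k : nat) (f : nat -> V) : (0 < k)%N ->
  \sum_(0 <= i < 3 * k - 1 | (i %% 3 == 1)%N) f i =
  \sum_(0 <= j < k) f (3 * j + 1)%N.
Proof.
case: k => // k _; elim: k => [|k IHk].
  by rewrite -[(3 * 1 - 1)%N]/2%N big_mkcond big_nat_recr // !big_nat1 /= add0r.
rewrite big_nat_recr //= -IHk.
have -> : (3 * k.+2 - 1 = (3 * k.+1 - 1).+3)%N by lia.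
have -> : (3 * k.+1 + 1 = (3 * k.+1 - 1).+2)%N by lia.
have: ((3 * k.+1 - 1) %% 3 = 2)%N by lia.
move: (3 * k.+1 - 1)%N => m m2; rewrite ![in LHS]big_mkcond !big_nat_recr //=.
have -> : (m %% 3 == 1)%N = false by rewrite m2.
have -> : (m.+1 %% 3 == 1)%N = false by lia.
have -> : (m.+2 %% 3 == 1)%N by lia.
by rewrite !addr0 -big_mkcond.
Qed.

(** * The root of unity and its powers *)

Section Omega.
Local Open Scope complex_scope.
Variable R : realType.
Implicit Types n k l : nat.

Lemma expr_omega n l :
  omega R n ^+ l = cos (2 * pi / n%:R * l%:R) +i* sin (2 * pi / n%:R * l%:R).
Proof.
rewrite /omega /cexp expR0 mul1r; move: (2 * pi / _) => t; elim: l => [|l IHl].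
  by rewrite mulr0 cos0 sin0.
rewrite exprS IHl -(natr1 l) mulrDr mulr1 addrC cosD sinD.
by congr (_ +i* _); ring.
Qed.

Lemma cos_lt1 (t : R) : 0 < t < 2 * pi -> cos t < 1.
Proof.
move=> /andP[t0 t2pi]; have : 0 < sin (t / 2).
  by apply: sin_gt0_pi; apply/andP; split; lra.
move=> s0; rewrite (_ : t = (t / 2) *+ 2); last by rewrite -mulr_natr; field.
have := cos2Dsin2 (t / 2); rewrite cos_mulr2n; nra.
Qed.

(** The order m of w divides n; if m < n, the angle 2 pi m / n would lie
    strictly between 0 and 2 pi, where the cosine is not 1. *)
Lemma prim_omega n : (0 < n)%N -> n.-primitive_root (omega R n).
Proof.
move=> n0; have nR : 0 < n%:R :> R by rewrite ltr0n.
have wn : omega R n ^+ n = 1.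
  rewrite expr_omega divfK ?gt_eqF // mulrC mulr_natr.
  by rewrite cos2pi sin2pi.
have [m prim_m] := prim_order_exists n0 wn.
move/(dvdn_leq n0); rewrite leq_eqVlt => /predU1P[mn|ltmn].
  by rewrite -{1}mn.
have := prim_expr_order prim_m; rewrite expr_omega => -[cos1 _].
have m0 := prim_order_gt0 prim_m.
suff: cos (2 * pi / n%:R * m%:R : R) < 1 by rewrite cos1 ltxx.
have pi2 : 0 < 2 * pi :> R by rewrite mulr_gt0 ?pi_gt0.
apply: cos_lt1; apply/andP; split; first by rewrite mulr_gt0 ?divr_gt0 ?ltr0n.
by rewrite mulrAC ltr_pdivrMr // (ltr_pM2l pi2) ltr_nat.
Qed.

(** The triple-angle formula at t = 2 pi / 3 says that c = cos t is a root of
    4 c ^ 3 - 3 c - 1 = (c - 1) (2 c + 1) ^ 2, and c < 1. *)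
Lemma cos_2pi3 : cos (2 * pi / 3 : R) = - 2^-1.
Proof.
set t : R := _ / 3; have pi0 := @pi_gt0 R.
have c1 : cos t < 1 by apply: cos_lt1; rewrite /t; apply/andP; split; lra.
have tE : t *+ 2 + t = pi *+ 2 by rewrite /t; lra.
have := @cos2pi R; rewrite -tE.
rewrite cosD cos_mulr2n sin_mulr2n; have := cos2Dsin2 t.
move: (cos t) (sin t) c1 => c s c1 cs e.
have : (c - 1) * (2 * c + 1) ^+ 2 = 0.
  have -> : (c - 1) * (2 * c + 1) ^+ 2
     = ((c ^+ 2 *+ 2 - 1) * c - c * s *+ 2 * s - 1)
       + 2 * c * (c ^+ 2 + s ^+ 2 - 1) by ring.
  by rewrite cs e; ring.
by move/eqP; rewrite mulf_eq0 sqrf_eq0 => /orP[] /eqP; lra.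
Qed.

(** * Closed form of the eigenvalues *)

Lemma char_poly_andrasfai k : (0 < k)%N ->
  char_poly (andrasfai_mx R k) =
    \prod_(0 <= l < andrasfai_order k) ('X - (andrasfai_eig R k l)%:P).
Proof.
move=> k0; have n1 : (1 < andrasfai_order k)%N by rewrite /andrasfai_order; lia.
have prim := prim_omega (ltnW n1).
rewrite /andrasfai_mx (char_poly_cayley_Zp _ n1 prim).
apply: eq_bigr => l _; congr ('X - _%:P).
pose f i := omega R (andrasfai_order k) ^+ (i * l).
transitivity (\sum_(0 <= i < (Zp_trunc (andrasfai_order k)).+2
                | (i %% 3 == 1)%N) f i).
  by rewrite big_mkord; apply: eq_bigl => s; rewrite inE.
by rewrite Zp_cast // /andrasfai_order sum_congr1_mod3.
Qed.

(** This is (z ^ 2 + z + 1) / z at z = exp (2 i pi l / n); when n = 3k - 1 and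
    0 < l < n it is the inverse of the l-th eigenvalue. *)
Definition eig_den n l : R := 1 + 2 * cos (2 * pi / n%:R * l%:R).

Lemma eig_den_sym n l : (0 < n)%N -> (l <= n)%N ->
  eig_den n (n - l) = eig_den n l.
Proof.
move=> n0 ln; have nR : n%:R != 0 :> R by rewrite pnatr_eq0 -lt0n.
rewrite /eig_den natrB // -[in RHS]cosN -[in RHS]cosD2pi.
suff -> : 2 * pi / n%:R * (n%:R - l%:R) = - (2 * pi / n%:R * l%:R) + pi *+ 2 :> R.
  by [].
by move: (@pi R) => p; field.
Qed.

Let angle_itv n l : (0 < n)%N -> (2 * l <= n)%N ->
  2 * pi / n%:R * l%:R \in `[0, pi : R].
Proof.
move=> n0 ln; have nR : 0 < n%:R :> R by rewrite ltr0n.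
rewrite in_itv /=; have pi0 := @pi_gt0 R; apply/andP; split.
  by rewrite !mulr_ge0 ?invr_ge0 ?ler0n //; lra.
rewrite mulrAC ler_pdivrMr // mulrAC mulrC ler_pM2l //.
by rewrite -natrM ler_nat.
Qed.

Lemma ltr_eig_den n l m : (0 < n)%N -> (2 * l <= n)%N -> (2 * m <= n)%N ->
  (eig_den n l < eig_den n m) = (m < l)%N.
Proof.
move=> n0 ln mn; have nR : 0 < n%:R :> R by rewrite ltr0n.
rewrite /eig_den ltrD2l ltr_pM2l // ltr_cos ?angle_itv //.
by rewrite ltr_pM2l ?ltr_nat // !mulr_gt0 ?invr_gt0 // pi_gt0.
Qed.

Lemma eig_den_gt0 n l : (3 * l < n)%N -> 0 < eig_den n l.
Proof.
move=> ln; have n0 : (0 < n)%N by lia.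
have nR : 0 < n%:R :> R by rewrite ltr0n.
suff: cos (2 * pi / 3 : R) < cos (2 * pi / n%:R * l%:R).
  by rewrite cos_2pi3 /eig_den; lra.
have pi0 := @pi_gt0 R.
rewrite ltr_cos; first last.
- by rewrite in_itv /=; apply/andP; split; lra.
- by apply: angle_itv; lia.
have: 3 * l%:R < n%:R :> R by rewrite -natrM ltr_nat.
move=> h; rewrite -!mulrA !ltr_pM2l // mulrC ltr_pdivrMr //; lra.
Qed.

Lemma eig_den_lt0 n l : (n < 3 * l)%N -> (2 * l <= n)%N -> eig_den n l < 0.
Proof.
move=> nl ln; have n0 : (0 < n)%N by lia.
have nR : 0 < n%:R :> R by rewrite ltr0n.
suff: cos (2 * pi / n%:R * l%:R) < cos (2 * pi / 3 : R).
  by rewrite cos_2pi3 /eig_den; lra.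
have pi0 := @pi_gt0 R.
rewrite ltr_cos; first last.
- by apply: angle_itv; lia.
- by rewrite in_itv /=; apply/andP; split; lra.
have: n%:R < 3 * l%:R :> R by rewrite -natrM ltr_nat.
move=> h; rewrite -!mulrA !ltr_pM2l // mulrC ltr_pdivlMr //; lra.
Qed.

(** Multiply the sum by z ^ 3 - 1 to telescope it, then use z ^ n = 1 with
    3k = n + 1 to see that the factor z - 1 cancels.  The resulting equation
    eig_den * x_l = 1 also shows that eig_den is nonzero. *)
Lemma andrasfai_eigE k l : (0 < k)%N -> (0 < l < andrasfai_order k)%N ->
  andrasfai_eig R k l = (eig_den (andrasfai_order k) l)^-1%:C.
Proof.
move=> k0 /andP[l0 ln]; set n := andrasfai_order k in ln *.
have n0 : (0 < n)%N by rewrite /n /andrasfai_order; lia.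
have prim := prim_omega n0.
set z := omega R n ^+ l.
have zn : z ^+ n = 1 by rewrite /z exprAC (prim_expr_order prim) expr1n.
have z1 : z != 1.
  rewrite -(expr0 (omega R n)) (eq_prim_root_expr prim) mod0n modn_small //.
  by rewrite -lt0n.
have z0 : z != 0.
  by apply/eqP => z0; move/eqP: zn; rewrite z0 expr0n gtn_eqF // eq_sym oner_eq0.
have -> : andrasfai_eig R k l = \sum_(0 <= j < k) z ^+ (3 * j + 1).
  by apply: eq_bigr => j _; rewrite mulnC exprM.
set S := \sum_(_ <= _ < _) _.
have telescope : (z ^+ 3 - 1) * S = z ^+ 2 - z.
  have -> : (z ^+ 3 - 1) * S = z ^+ (3 * k + 1) - z ^+ (3 * 0 + 1).
    rewrite -[RHS](telescope_sumr (fun j => z ^+ (3 * j + 1))) // mulr_sumr.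
    apply: eq_bigr => j _; rewrite mulrBl mul1r -exprD; congr (z ^+ _ - _); lia.
  have -> : (3 * k + 1 = n + 2)%N by rewrite /n /andrasfai_order; lia.
  by rewrite exprD zn mul1r.
have quad : z ^+ 2 + z + 1 = z * (eig_den n l)%:C.
  rewrite /z expr_omega /eig_den; set t := _ * l%:R.
  have := cos2Dsin2 t; move: (cos t) (sin t) => c s cs.
  rewrite expr2; apply/eqP; rewrite eq_complex /=; apply/andP; split; apply/eqP.
    by nra.
  by ring.
have prod1 : (eig_den n l)%:C * S = 1.
  have zz1 : (z - 1) * z != 0 by rewrite mulf_neq0 // subr_eq0.
  apply: (mulfI zz1); rewrite mulr1 mulrA -(mulrA (z - 1)) -quad.
  transitivity ((z ^+ 3 - 1) * S); first by ring.
  by rewrite telescope; ring.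
have d0 : (eig_den n l)%:C != 0.
  by apply/eqP => d0; move/eqP: prod1; rewrite d0 mul0r eq_sym oner_eq0.
by rewrite fmorphV; apply: (mulfI d0); rewrite prod1 divff.
Qed.

Lemma andrasfai_eig0 k : andrasfai_eig R k 0 = k%:R.
Proof.
rewrite /andrasfai_eig (eq_bigr (fun=> 1)); last by move=> j _; rewrite muln0.
by rewrite big_const_nat subn0 iter_addr_0.
Qed.

Lemma andrasfai_eig_sym k l : (0 < k)%N -> (0 < l < andrasfai_order k)%N ->
  andrasfai_eig R k (andrasfai_order k - l) = andrasfai_eig R k l.
Proof. by move=> k0 ?; rewrite !andrasfai_eigE ?eig_den_sym //; lia. Qed.

(** * The smallest eigenvalue *)

(** By symmetry l <= n / 2.  For 3 l < n the eigenvalue is positive whereas the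
    k-th one is negative; for 3 l > n, that is l >= k, both denominators are
    negative and the one at k is the larger, so its inverse is the smaller. *)
Lemma andrasfai_eig_min k l : (1 < k)%N -> (l < andrasfai_order k)%N ->
  andrasfai_eig R k k <= andrasfai_eig R k l.
Proof.
move=> k1; set n := andrasfai_order k => ln.
have nE : n = (3 * k - 1)%N by [].
have xkE : andrasfai_eig R k k = (eig_den n k)^-1%:C.
  by apply: andrasfai_eigE; rewrite -?/n; lia.
have dk0 : eig_den n k < 0 by apply: eig_den_lt0; lia.
have [->|l0] := posnP l.
  rewrite andrasfai_eig0 xkE -(rmorph_nat (real_complex R)) lecR.
  by rewrite (@le_trans _ _ 0) ?ler0n // invr_le0 ltW.
wlog l2n : l ln l0 / (2 * l <= n)%N.
  move=> wlog_l; have [|nl] := leqP (2 * l) n; first exact: wlog_l.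
  by rewrite -(@andrasfai_eig_sym k l) -?/n; [apply: wlog_l|..]; lia.
rewrite xkE andrasfai_eigE -?/n; try lia.
rewrite lecR; have [l3n|n3l] := ltnP (3 * l) n.
  by rewrite (@le_trans _ _ 0) // ?invr_le0 ?invr_ge0 ltW // eig_den_gt0.
have dl0 : eig_den n l < 0 by apply: eig_den_lt0; lia.
by rewrite lef_nV2 ?negrE // leNgt ltr_eig_den; lia.
Qed.

End Omega.

Theorem theorem3p2 (R : realType) (k : nat) (hk : (2 <= k)%N) :
  let n := andrasfai_order k in
  let A := andrasfai_mx R k in
  let x := andrasfai_eig R k in
  [/\ char_poly A = \prod_(0 <= l < n) ('X - (x l)%:P),
      x k = x (2 * k - 1)%N,
      forall l : nat, (l < n)%N -> x k <= x l
    & eigenvalue A (x k) /\ (forall a : R[i], eigenvalue A a -> x k <= a)].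
Proof.
move=> n A x; have k0 : (0 < k)%N by lia.
have nE : n = (3 * k - 1)%N by [].
have xmin l : (l < n)%N -> x k <= x l by apply: andrasfai_eig_min.
have cpA := char_poly_andrasfai R k0.
have eigA a : eigenvalue A a = (a \in [seq x l | l <- index_iota 0 n]).
  by rewrite eigenvalue_root_char cpA -root_prod_XsubC big_map.
split=> //.
  rewrite /x -andrasfai_eig_sym -?/n //; last by lia.
  by congr andrasfai_eig; lia.
split; first by rewrite eigA; apply: map_f; rewrite mem_index_iota; lia.
move=> a; rewrite eigA => /mapP[l]; rewrite mem_index_iota => ln ->.
exact: xmin.
Qed.
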